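(* For any even integer $m\geq 2$, $$\int_0^1 \frac{\log \left(x^{2m}+1\right)}{x^2+1}\,dx=\frac{m\pi}{4}\log 2-mG+\frac{\pi}{2}\sum_{k=0}^{\frac{m}{2}-1}\log\left(1+\sqrt{\frac{1-\varphi_k}{2}}\right),$$ and for any odd integer $m\geq 1$, $$\int_0^1 \frac{\log \left(x^{2 m}+1\right)}{x^2+1}\,dx=\frac{(m+1)\pi}{4}\log 2-mG+\frac{\pi}{2}\sum_{k=0}^{\frac{m-3}{2}}\log\left(1+\sqrt{\frac{1-\varphi_k}{2}}\right),$$ where $\varphi_k=\cos\left(\frac{(2k+1)\pi}{m}\right)$ and $G$ is the Catalan constant.
   Context: The Catalan constant is $G=\sum_{n=0}^\infty \frac{(-1)^n}{(2n+1)^2}$. An empty sum $\sum_{k=0}^{-1}(\cdot)$ is taken to be zero. *)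

(* Defs.v *)
From Stdlib Require Import Reals List Arith.
From Coquelicot Require Import Coquelicot.
Open Scope R_scope.

Definition Catalan : R :=
  Series (fun n : nat => (-1) ^ n / (2 * INR n + 1) ^ 2).

(** [sum_lt f n] is the sum of [f k] over [0 <= k < n], which is [0] for [n = 0];
    Stdlib's [sum_f_R0] and Coquelicot's [sum_n] include the upper index and so
    cannot express an empty sum. *)
Definition sum_lt (f : nat -> R) (n : nat) : R :=
  fold_right Rplus 0 (map f (seq 0 n)).

Definition phi (m k : nat) : R := cos ((2 * INR k + 1) * PI / INR m).

(* Main.v *)
(** With [y = x^2], the polynomial [y^m + 1] is the product of the quadratics
    [y^2 - 2 phi_k y + 1], times [y + 1] when [m] is odd, so the integral splits into
    integrals of [ln (x^4 - 2 p x^2 + 1) / (1 + x^2)] and [ln (1 + x^2) / (1 + x^2)].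
    Both are found by differentiating under the integral sign.

    With [t = sqrt ((1 - p) / 2)], the quartic is [(1 - x^2)^2 + 4 t^2 x^2]; its
    integral has [t]-derivative [PI / 2 / (1 + t)], and at [t = 1] the quartic is
    [(1 + x^2)^2].

    For the remaining integral, use
    [(1 + x^2) + 2 (1 - x^2) r + (1 + x^2) r^2], which runs from [1 + x^2] at [r = 0]
    to [4] at [r = 1]. The [r]-derivative of its integral is [atan r / r], whose Taylor
    series integrates termwise over [0, 1] to the series of the Catalan constant. *)

Require Import Defs.
From Stdlib Require Import Reals List Arith Lra Lia.
From Coquelicot Require Import Coquelicot.
From mathcomp Require all_boot all_algebra ring Rstruct.
Open Scope R_scope.

(** ** Factorization of [y^m + 1] *)

(** Adding the sines of [(k + 1) th + th] and [(k + 1) th - th] gives this Chebyshev recurrence,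
    which drives the reduction modulo the quadratics below. *)
Lemma sin_recurrence (th : R) (k : nat) :
  sin (INR (S (S k)) * th) = 2 * cos th * sin (INR (S k) * th) - sin (INR k * th).
Proof.
  replace (INR (S (S k)) * th) with (INR (S k) * th + th) by (rewrite !S_INR; ring).
  replace (INR k * th) with (INR (S k) * th - th) by (rewrite !S_INR; ring).
  rewrite sin_plus, sin_minus. ring.
Qed.

(** This is the value at [y = -1] of [y^2 - 2 cos th y + 1], so [y + 1] shares no root with that
    quadratic. *)
Lemma two_add_2cos_neq0 (th : R) : sin th <> 0 -> 2 + 2 * cos th <> 0.
Proof.
  intros H E. apply H. assert (S := sin2_cos2 th).
  replace (cos th) with (-1) in S by lra. unfold Rsqr in S. nra.
Qed.

(** * Divisibility by pairwise coprime quadratics *)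

Module Factorization.
Import all_boot all_algebra ring Rstruct.
Import GRing.Theory.
Local Open Scope ring_scope.
Set Implicit Arguments. Unset Strict Implicit.

(** For [c = 2 cos th] the complex roots are [exp (i th)] and [exp (- i th)]; keeping the pair
    together avoids complex numbers. *)
Definition quad (F : fieldType) (c : F) : {poly F} := 'X^2 - c *: 'X + 1.

Lemma size_quad (F : fieldType) (c : F) : size (quad c) = 3%N.
Proof.
rewrite /quad -addrA size_polyDl size_polyXn //.
rewrite (leq_ltn_trans (size_polyD _ _)) // gtn_max size_polyC.
rewrite size_polyN (leq_ltn_trans (size_scale_leq _ _)) ?size_polyX //.
by rewrite oner_eq0.
Qed.

Lemma monic_quad (F : fieldType) (c : F) : quad c \is monic.
Proof.
by rewrite monicE lead_coefE size_quad /quad !coefE /= mulr0 subr0 addr0.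
Qed.

(** The two differ by [(c - d) X], and [X] is coprime to [quad c], whose constant term is 1. *)
Lemma coprimep_quad (F : fieldType) (c d : F) :
  c != d -> coprimep (quad c) (quad d).
Proof.
move=> cd.
have -> : quad d = 1 * quad c + (c - d) *: 'X.
  by rewrite /quad mul1r scalerBl [LHS]addrAC [X in _ = X + _]addrAC addrA subrK.
rewrite coprimep_addl_mul coprimepZr ?subr_eq0 //.
rewrite -[X in coprimep _ X]subr0 -polyC0 coprimep_XsubC.
by rewrite /root /quad !hornerE expr0n /= ?mulr0 ?subr0 ?add0r oner_eq0.
Qed.

Lemma prod_quad_dvdp (F : fieldType) (cs : seq F) (p : {poly F}) :
  uniq cs -> (forall c, c \in cs -> quad c %| p) -> \prod_(c <- cs) quad c %| p.
Proof.
elim: cs => [|c cs IH] /=; first by rewrite big_nil dvd1p.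
case/andP=> ccs ucs H; rewrite big_cons Gauss_dvdp ?H ?mem_head //=.
  by apply: IH => // d dcs; apply: H; rewrite inE dcs orbT.
rewrite big_seq; apply: (big_rec (fun q => coprimep (quad c) q)) => [|d q dcs cq].
  exact: coprimep1.
rewrite coprimepMr cq andbT coprimep_quad //.
by apply: contraNneq ccs => ->.
Qed.

(* Modulo [quad c], [s 1 *: 'X^n.+1] reduces to [s n.+1 *: 'X - (s n)%:P]. *)
Lemma dvdp_quad_Xn_add1 (F : fieldType) (c : F) (s : nat -> F) (n : nat) :
    (forall k, s k.+2 = c * s k.+1 - s k) -> s 0 = 0 -> s 1 != 0 ->
    s n.+1 = 0 -> s n = s 1 ->
  quad c %| 'X^(n.+1) + 1.
Proof.
move=> sS s0 s1 sn1 sn.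
(* At [k = n] the remainder is the constant [- s 1], so [quad c] divides [s 1] times
   [X^(n+1) + 1]. *)
suff H k : quad c %| s 1 *: 'X^(k.+1) - (s k.+1 *: 'X - (s k)%:P).
  have := H n.
  rewrite sn1 sn scale0r sub0r opprK -[(s 1)%:P]mulr1 mul_polyC -scalerDr.
  by rewrite dvdpZr.
elim: k => [|k IH]; first by rewrite s0 subr0 subrr dvdp0.
have -> : s 1 *: 'X^(k.+2) - (s k.+2 *: 'X - (s k.+1)%:P) =
    (s 1 *: 'X^(k.+1) - (s k.+1 *: 'X - (s k)%:P)) * 'X + s k.+1 *: quad c.
  rewrite sS /quad -!mul_polyC !exprS expr0; ring.
rewrite -[s k.+1 *: quad c]mul_polyC.
by apply: dvdp_add; [apply: dvdp_mulr | apply: dvdp_mull].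
Qed.

Lemma size_prod_quad (F : fieldType) (cs : seq F) :
  size (\prod_(c <- cs) quad c) = (size cs).*2.+1.
Proof.
elim: cs => [|c cs IH]; first by rewrite big_nil size_poly1.
rewrite big_cons size_monicM ?monic_quad ?size_quad ?IH //.
by rewrite -size_poly_eq0 IH.
Qed.

(** A divisor of full degree is a scalar multiple, and monicity makes the scalar 1. *)
Lemma eq_monic_dvdp (F : fieldType) (p q : {poly F}) :
  p \is monic -> q \is monic -> p %| q -> size p = size q -> p = q.
Proof.
move=> mp mq pq spq; apply/eqP; rewrite -eqp_monic //.
by rewrite -dvdp_size_eqp // spq.
Qed.

Lemma monic_prod_quad (F : fieldType) (cs : seq F) :
  \prod_(c <- cs) quad c \is monic.
Proof. by apply: monic_prod => c _; exact: monic_quad. Qed.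

(** Distinct quadratics are coprime, so their product divides [X^m + 1]; both are monic of degree
    [m]. *)
Lemma Xn_add1_even (F : fieldType) (cs : seq F) (m : nat) :
    uniq cs -> (forall c, c \in cs -> quad c %| 'X^m + 1) ->
    m = (size cs).*2 -> (0 < m)%N ->
  'X^m + 1 = \prod_(c <- cs) quad c.
Proof.
move=> ucs H mE m0.
have XnE : 'X^m + 1 = 'X^m - (-1)%:P :> {poly F} by rewrite polyCN opprK.
symmetry; apply: eq_monic_dvdp.
- exact: monic_prod_quad.
- by rewrite XnE monicXnsubC.
- exact: prod_quad_dvdp.
- by rewrite size_prod_quad XnE size_XnsubC // mE.
Qed.

(** For odd [m], [-1] is a root of [X^m + 1]. Since [quad c] takes the value [2 + c] at [-1], the
    factor [X + 1] is coprime to the quadratics and supplies the missing degree. *)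
Lemma Xn_add1_odd (F : fieldType) (cs : seq F) (m : nat) :
    uniq cs -> (forall c, c \in cs -> quad c %| 'X^m + 1) ->
    (forall c, c \in cs -> 2 + c != 0) -> m = (size cs).*2.+1 ->
  'X^m + 1 = ('X + 1) * \prod_(c <- cs) quad c.
Proof.
move=> ucs H c2 mE.
have XE : 'X + 1 = 'X - (-1)%:P :> {poly F} by rewrite polyCN opprK.
have XnE : 'X^m + 1 = 'X^m - (-1)%:P :> {poly F} by rewrite polyCN opprK.
have m0 : (0 < m)%N by rewrite mE.
symmetry; apply: eq_monic_dvdp.
- by rewrite monicMl ?monic_prod_quad // XE monicXsubC.
- by rewrite XnE monicXnsubC.
- rewrite Gauss_dvdp; last first.
    rewrite coprimep_sym XE coprimep_XsubC /root horner_prod prodf_seq_neq0.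
    apply/allP => c /c2; rewrite /quad !hornerE /=.
    by apply: contraNneq => e; apply/eqP; rewrite -e; ring.
  rewrite prod_quad_dvdp // andbT XE dvdp_XsubCl /root !hornerE mE.
  by rewrite exprS -mul2n exprM sqrrN !expr1n mulr1 addNr.
- rewrite size_monicM ?XE ?monicXsubC ?size_XsubC ?size_prod_quad //.
    by rewrite XnE size_XnsubC // mE.
  by rewrite -size_poly_eq0 size_prod_quad.
Qed.

(** The sequence [s k = sin (k th)] satisfies the recurrence with [c = 2 cos th]. *)
Lemma dvdp_quad_2cos (th : R) (n : nat) :
    sin th <> 0 -> sin (INR n.+1 * th) = 0 -> sin (INR n * th) = sin th ->
  quad (2 * cos th) %| 'X^(n.+1) + 1.
Proof.
move=> s0 sm sn.
apply: (@dvdp_quad_Xn_add1 _ _ (fun k => sin (INR k * th))).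
- by move=> k; rewrite sin_recurrence; rewrite !RealsE.
- by rewrite INRE mulr0n RmultE mul0r sin_0.
- by apply/eqP; rewrite INRE mulr1n RmultE mul1r.
- exact: sm.
- by rewrite [INR 1]INRE mulr1n !RmultE mul1r.
Qed.

Lemma uniq_2cos (n : nat) (th : nat -> R) :
    (forall i j, Peano.lt i n -> Peano.lt j n -> cos (th i) = cos (th j) -> i = j) ->
  uniq [seq 2 * cos (th i) | i <- iota 0 n].
Proof.
move=> inj; rewrite map_inj_in_uniq ?iota_uniq // => i j.
rewrite !mem_iota /= !add0n => /ltP lin /ltP ljn /mulfI e.
by apply: inj => //; apply: e; apply/eqP => /eqP; rewrite Num.Theory.pnatr_eq0.
Qed.

Local Open Scope R_scope.

(** Carries the polynomial product over to list folds of real numbers. The start index [k] is free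
    because the induction shifts it. *)
Lemma horner_prod_quad (k n : nat) (th : nat -> R) (y : R) :
  (\prod_(c <- [seq (2 * cos (th i))%R | i <- iota k n]) quad c).[y]%R =
  List.fold_right Rmult 1
    (List.map (fun k => y ^ 2 - 2 * cos (th k) * y + 1) (List.seq k n)).
Proof.
rewrite (List.map_ext _ (fun i => (quad (2 * cos (th i))%R).[y]%R)); last first.
  by move=> i; rewrite /quad !hornerE !RealsE.
elim: n k => [|n IH] k /=; first by rewrite big_nil hornerC.
by rewrite big_cons hornerM IH.
Qed.

Lemma pow_add1_even (m n : nat) (th : nat -> R) (y : R) :
    m = (2 * n)%coq_nat -> (0 < n)%coq_nat ->
    (forall i, (i < n)%coq_nat ->
       sin (th i) <> 0 /\ sin (INR m * th i) = 0 /\ sin (INR m.-1 * th i) = sin (th i)) ->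
    (forall i j, (i < n)%coq_nat -> (j < n)%coq_nat -> cos (th i) = cos (th j) -> i = j) ->
  y ^ m + 1 = List.fold_right Rmult 1
    (List.map (fun k => y ^ 2 - 2 * cos (th k) * y + 1) (List.seq 0 n)).
Proof.
rewrite multE => mE n0 H inj; rewrite -horner_prod_quad -(@Xn_add1_even _ _ m).
- by rewrite !hornerE !RealsE.
- exact: uniq_2cos.
- move=> c /mapP [i]; rewrite mem_iota add0n /= => /ltP /H [s0 [sm sn]] ->.
  have e : m = m.-1.+1 by rewrite mE; move/ltP: n0; case: (n).
  by rewrite e; apply: dvdp_quad_2cos => //; rewrite -e.
- by rewrite size_map size_iota mE mul2n.
- by rewrite mE muln_gt0; apply/ltP.
Qed.

Lemma pow_add1_odd (m n : nat) (th : nat -> R) (y : R) :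
    m = ((2 * n)%coq_nat + 1)%coq_nat ->
    (forall i, (i < n)%coq_nat ->
       sin (th i) <> 0 /\ sin (INR m * th i) = 0 /\ sin (INR m.-1 * th i) = sin (th i)) ->
    (forall i j, (i < n)%coq_nat -> (j < n)%coq_nat -> cos (th i) = cos (th j) -> i = j) ->
  y ^ m + 1 = (y + 1) * List.fold_right Rmult 1
    (List.map (fun k => y ^ 2 - 2 * cos (th k) * y + 1) (List.seq 0 n)).
Proof.
rewrite multE plusE addn1 => mE H inj; rewrite -horner_prod_quad.
have := @Xn_add1_odd _ [seq (2 * cos (th i))%R | i <- iota 0 n] m.
move/(_ (uniq_2cos inj)) => E.
have /(congr1 (fun p => p.[y]%R)) : ('X^m + 1 =
    ('X + 1) * \prod_(c <- [seq 2 * cos (th i) | i <- iota 0 n]) quad c :> {poly R})%R.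
  apply: E.
  - move=> c /mapP [i]; rewrite mem_iota add0n /= => /ltP /H [s0 [sm sn]] ->.
    by move: sm sn; rewrite mE; apply: dvdp_quad_2cos.
  - move=> c /mapP [i]; rewrite mem_iota add0n /= => /ltP /H [/two_add_2cos_neq0 c0 _] ->.
    by apply/eqP; move: c0; rewrite !RealsE.
  - by rewrite size_map size_iota mE mul2n.
by rewrite hornerM !hornerE !RealsE.
Qed.

End Factorization.

(** ** The two parametric integrals *)

(** Differentiation under the integral sign, for a general quadratic in [t] so that both families
    are instances; hence the terms [0 * t] later. Positivity near [t0], uniformly in [x], keeps the
    logarithm smooth. *)
Lemma is_derive_RInt_ln_quadratic (A B C : R -> R) (t0 : R) :
  (forall x, continuity_pt A x) -> (forall x, continuity_pt B x) ->
  (forall x, continuity_pt C x) ->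
  locally t0 (fun t => forall x, 0 < A x + B x * t + C x * t ^ 2) ->
  is_derive (fun t => RInt (fun x => ln (A x + B x * t + C x * t ^ 2) / (1 + x ^ 2)) 0 1) t0
    (RInt (fun x => (B x + C x * (2 * t0)) / (A x + B x * t0 + C x * t0 ^ 2) / (1 + x ^ 2)) 0 1).
Proof.
  intros cA cB cC Hpos.
  assert (HD : forall t x, 0 < A x + B x * t + C x * t ^ 2 ->
    is_derive (fun u => ln (A x + B x * u + C x * u ^ 2) / (1 + x ^ 2)) t
     ((B x + C x * (2 * t)) / (A x + B x * t + C x * t ^ 2) / (1 + x ^ 2))).
  { intros t x H. assert (0 < 1 + x ^ 2) by nra.
    auto_derive; simpl in *; [ repeat split; lra | field; lra ]. }
  assert (P0 := locally_singleton _ _ Hpos). simpl in P0.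
  rewrite (RInt_ext (fun x => (B x + C x * (2 * t0)) / (A x + B x * t0 + C x * t0 ^ 2) / (1 + x ^ 2))
     (fun x => Derive (fun u => ln (A x + B x * u + C x * u ^ 2) / (1 + x ^ 2)) t0)).
  2:{ intros x _. symmetry. apply is_derive_unique, HD, P0. }
  apply (is_derive_RInt_param (fun t x => ln (A x + B x * t + C x * t ^ 2) / (1 + x ^ 2))).
  - revert Hpos; apply filter_imp; intros t Ht x _; eexists. apply HD, Ht.
  - intros x _.
    (* The derivative is rewritten with products and inverses only, the shapes for which joint
       continuity is proved rule by rule. *)
    apply continuity_2d_pt_ext_loc with
      (fun t x => (B x + C x * (2 * t)) * / (A x + B x * t + C x * (t * t)) * / (1 + x * x)).
    + destruct Hpos as [d Hd]. exists d. intros u v Hu _. symmetry.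
      erewrite is_derive_unique. 2: apply HD, Hd, Hu.
      unfold Rdiv. now simpl; rewrite !Rmult_1_r.
    + repeat first
        [ apply continuity_2d_pt_plus | apply continuity_2d_pt_mult
        | apply continuity_2d_pt_inv | apply continuity_2d_pt_const
        | apply continuity_2d_pt_id1 | apply continuity_2d_pt_id2 ];
        try (apply (continuity_1d_2d_pt_comp _ (fun _ v => v)); [ auto | apply continuity_2d_pt_id2 ]).
      * specialize (P0 x). simpl in P0. nra.
      * nra.
  - revert Hpos; apply filter_imp; intros t Ht.
    apply (ex_RInt_continuous (V := R_CompleteNormedModule)); intros x _.
    apply continuity_pt_filterlim.
    apply continuity_pt_mult.
    + apply (continuity_pt_comp (fun x => A x + B x * t + C x * t ^ 2) ln).
      * apply continuity_pt_plus; [apply continuity_pt_plus|]; auto;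
        apply continuity_pt_mult; auto; now apply continuity_pt_const.
      * apply derivable_continuous_pt. exists (/ (A x + B x * t + C x * t ^ 2)). now apply derivable_pt_lim_ln.
    + apply continuity_pt_inv.
      * apply derivable_continuous_pt. exists (2 * x). apply is_derive_Reals. auto_derive; [ auto | ring].
      * nra.
Qed.

(** * Integrals of the parameter derivatives *)

Lemma continuity_pt_of_ex_derive (f : R -> R) (x : R) : ex_derive f x -> continuity_pt f x.
Proof.
  intros H. apply continuity_pt_filterlim. now apply (ex_derive_continuous (V := R_NormedModule)).
Qed.

Lemma is_RInt_antiderivative (F f : R -> R) (v : R) :
  (forall x, 0 <= x <= 1 -> is_derive F x (f x)) ->
  (forall x, 0 <= x <= 1 -> ex_derive f x) ->
  F 1 - F 0 = v -> is_RInt f 0 1 v.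
Proof.
  intros HF Hf <-. apply (is_RInt_derive (V := R_CompleteNormedModule));
    rewrite Rmin_left, Rmax_right by lra; auto.
  intros x Hx. now apply (ex_derive_continuous (V := R_NormedModule)), Hf.
Qed.

(** With [u = 2 atan x] the integrand becomes [t sin^2 u / (cos^2 u + t^2 sin^2 u)] in [u], that is,
    [t / (1 - t^2)] times [1 / (cos^2 u + t^2 sin^2 u) - 1]; [u] runs from 0 to [PI / 2]. *)
Lemma RInt_quartic_derivative (t : R) : 0 < t < 1 ->
  RInt (fun x => (0 + 4 * x ^ 2 * (2 * t)) / ((1 - x ^ 2) ^ 2 + 0 * t + 4 * x ^ 2 * t ^ 2)
                 / (1 + x ^ 2)) 0 1 = PI / 2 / (1 + t).
Proof.
  intros Ht. apply is_RInt_unique.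
  (* With [u = 2 atan x], the primitive [atan (t tan u)] is singular at [x = 1]; this is
     [u - atan ((1 - t) tan u / (1 + t tan^2 u))], which is smooth on [[0, 1]]. *)
  apply is_RInt_antiderivative with (fun x => 2 * t / (1 - t ^ 2) *
    ((2 * atan x - atan ((1 - t) * (2 * x * (1 - x ^ 2)) / ((1 - x ^ 2) ^ 2 + 4 * t * x ^ 2))) / (2 * t)
     - atan x)).
  - intros x Hx.
    assert (0 < (1 - x ^ 2) ^ 2 + 4 * t * x ^ 2).
    { destruct (Req_dec x 1) as [-> |]; [lra|].
      assert (0 < (1 - x ^ 2) ^ 2) by (apply pow2_gt_0; nra). nra. }
    assert (0 < (1 - x ^ 2) ^ 2 + 0 * t + 4 * x ^ 2 * t ^ 2).
    { destruct (Req_dec x 1) as [-> |]; [nra|].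
      assert (0 < (1 - x ^ 2) ^ 2) by (apply pow2_gt_0; nra). nra. }
    assert (0 < 1 + x ^ 2) by nra.
    evar_last; [auto_derive; [repeat split; simpl in *; lra | reflexivity] |].
    unfold Rsqr. simpl. field. simpl in *.
    (* Differentiating [atan (v / u)] leaves denominators of the form [u^2 + v^2]. *)
    assert (E : forall u v, 0 < u -> u * u + v * v <> 0) by (intros; nra).
    repeat split; try lra; try (apply E; lra); nra.
  - intros x Hx.
    assert (0 < (1 - x ^ 2) ^ 2 + 0 * t + 4 * x ^ 2 * t ^ 2).
    { destruct (Req_dec x 1) as [-> |]; [nra|].
      assert (0 < (1 - x ^ 2) ^ 2) by (apply pow2_gt_0; nra). nra. }
    assert (0 < 1 + x ^ 2) by nra.
    auto_derive. simpl in *. repeat split; lra.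
  - rewrite atan_1, !atan_0.
    replace ((1 - t) * (2 * 1 * (1 - 1 ^ 2)) / ((1 - 1 ^ 2) ^ 2 + 4 * t * 1 ^ 2)) with 0 by (field; lra).
    replace ((1 - t) * (2 * 0 * (1 - 0 ^ 2)) / ((1 - 0 ^ 2) ^ 2 + 4 * t * 0 ^ 2)) with 0 by (field; lra).
    rewrite atan_0. field. nra.
Qed.

Lemma RInt_poisson_derivative (r : R) : 0 < r < 1 ->
  RInt (fun x => (2 * (1 - x ^ 2) + (1 + x ^ 2) * (2 * r)) /
                 (1 + x ^ 2 + 2 * (1 - x ^ 2) * r + (1 + x ^ 2) * r ^ 2) / (1 + x ^ 2)) 0 1
  = atan r / r.
Proof.
  intros Hr. apply is_RInt_unique.
  assert (HD : forall x, 0 <= x <= 1 -> 0 < 1 + x ^ 2 + 2 * (1 - x ^ 2) * r + (1 + x ^ 2) * r ^ 2).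
  { intros x Hx. assert (0 <= (1 - x ^ 2) * r) by (apply Rmult_le_pos; nra). nra. }
  (* The denominator is [(1 + r)^2 + (1 - r)^2 x^2], so partial fractions give
     [(atan x - atan (q x)) / r] with [q = (1 - r) / (1 + r)]; the subtraction formula merges the
     arctangents, and [x = 1] gives [atan r] directly. *)
  apply is_RInt_antiderivative with (fun x => atan (2 * r * x / (1 + r + (1 - r) * x ^ 2)) / r).
  - intros x Hx. specialize (HD x Hx).
    assert (0 < 1 + r + (1 - r) * x ^ 2) by nra.
    assert (0 < 1 + x ^ 2) by nra.
    evar_last; [auto_derive; [repeat split; simpl in *; lra | reflexivity] |].
    unfold Rsqr. simpl. field. simpl in *.
    assert (E : forall u v, 0 < u -> u * u + v * v <> 0) by (intros; nra).
    repeat split; try lra; try (apply E; lra); nra.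
  - intros x Hx. specialize (HD x Hx).
    assert (0 < 1 + x ^ 2) by nra.
    auto_derive. simpl in *. repeat split; lra.
  - replace (2 * r * 1 / (1 + r + (1 - r) * 1 ^ 2)) with r by (field; lra).
    replace (2 * r * 0 / (1 + r + (1 - r) * 0 ^ 2)) with 0 by (field; lra).
    rewrite atan_0. field. lra.
Qed.

(* [ring] and [field] do not see through Coquelicot's structures on [R]. *)
Ltac real_eq := match goal with |- ?a = ?b => change (@eq R a b) end.

(** * Arctangent series and the Catalan constant *)

Lemma sum_n_alternating_geometric (x : R) (n : nat) :
  sum_n (fun k => (-1) ^ k * x ^ (2 * k)) n = (1 - (-1) ^ S n * x ^ (2 * S n)) / (1 + x ^ 2).
Proof.
  assert (0 < 1 + x ^ 2) by nra.
  induction n as [|n IH].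
  - rewrite sum_O. simpl in *. field. lra.
  - rewrite sum_Sn, IH. change (@plus R_AbelianMonoid) with Rplus.
    replace (2 * S (S n))%nat with (2 * S n + 2)%nat by lia.
    rewrite pow_add. rewrite <- (tech_pow_Rmult (-1) (S n)). real_eq. field. lra.
Qed.

Lemma odd_denominator_pos (k : nat) : 0 < 2 * INR k + 1.
Proof. assert (H := pos_INR k). lra. Qed.

Lemma nondecreasing_of_derive_nonneg (f df : R -> R) (r : R) : 0 < r ->
  (forall x, 0 <= x <= r -> is_derive f x (df x)) ->
  (forall x, 0 < x < r -> 0 <= df x) -> f 0 <= f r.
Proof.
  intros Hr Hd Hp.
  destruct (MVT_cor2 f df 0 r Hr) as [c [E Hc]].
  - intros c Hc. now apply is_derive_Reals, Hd.
  - specialize (Hp c Hc). nra.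
Qed.

Lemma is_derive_pow_odd (a x : R) (k : nat) :
  is_derive (fun x => a * x ^ (2 * k + 1) / (2 * INR k + 1)) x (a * x ^ (2 * k)).
Proof.
  assert (H := odd_denominator_pos k).
  auto_derive; [lra|].
  replace (Init.Nat.pred (k + (k + 0) + 1)) with (k + (k + 0))%nat by lia.
  rewrite !plus_INR, INR_0, INR_1. change (2 * k)%nat with (k + (k + 0))%nat. field. lra.
Qed.

(** By the geometric sum, the error [E] has derivative [(-1)^(n+1) x^(2n+2) / (1 + x^2)], bounded in
    absolute value by the derivative of the claimed bound [M]. So [M + E] and [M - E] are
    nondecreasing from 0. *)
Lemma atan_partial_sum_bound (n : nat) (r : R) : 0 < r ->
  Rabs (atan r - sum_n (fun k => (-1) ^ k * r ^ (2 * k + 1) / (2 * INR k + 1)) n)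
  <= r ^ (2 * S n + 1) / (2 * INR (S n) + 1).
Proof.
  intros Hr.
  set (E := fun x => atan x - sum_n (fun k => (-1) ^ k * x ^ (2 * k + 1) / (2 * INR k + 1)) n).
  set (M := fun x => 1 * x ^ (2 * S n + 1) / (2 * INR (S n) + 1)).
  assert (HE : forall x, is_derive E x ((-1) ^ S n * x ^ (2 * S n) / (1 + x ^ 2))).
  { intros x. assert (0 < 1 + x ^ 2) by nra.
    evar_last.
    - apply (is_derive_minus (V := R_NormedModule)); [apply is_derive_atan|].
      apply (is_derive_sum_n (V := R_NormedModule)) with (d := fun k => (-1) ^ k * x ^ (2 * k)).
      intros k _. apply is_derive_pow_odd.
    - rewrite sum_n_alternating_geometric. unfold minus, plus, opp; simpl.
      unfold Rsqr. real_eq. field. simpl in *. lra. }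
  assert (HM : forall x, is_derive M x (1 * x ^ (2 * S n))) by (intros; apply is_derive_pow_odd).
  assert (E0 : E 0 = 0).
  { unfold E. rewrite atan_0, (sum_n_ext _ (fun _ => 0)), sum_n_const; [real_eq; ring|].
    intros k. rewrite pow_i by lia. unfold Rdiv. real_eq. ring. }
  assert (M0 : M 0 = 0) by (unfold M; rewrite pow_i by lia; unfold Rdiv; ring).
  assert (B : forall x, Rabs ((-1) ^ S n * x ^ (2 * S n) / (1 + x ^ 2)) <= 1 * x ^ (2 * S n)).
  { intros x. assert (0 <= x ^ (2 * S n)) by (rewrite pow_mult; apply pow_le; nra).
    assert (0 < 1 + x ^ 2) by nra.
    revert H. generalize (x ^ (2 * S n)). intros p H.
    unfold Rdiv. rewrite !Rabs_mult, pow_1_abs, Rabs_inv, !(Rabs_pos_eq) by lra.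
    assert (/ (1 + x ^ 2) <= 1) by (rewrite <- Rinv_1; apply Rinv_le_contravar; nra).
    nra. }
  change (Rabs (E r) <= r ^ (2 * S n + 1) / (2 * INR (S n) + 1)).
  replace (r ^ (2 * S n + 1) / (2 * INR (S n) + 1)) with (M r) by (unfold M; now rewrite Rmult_1_l).
  apply Rabs_le. split.
  - assert (M 0 + E 0 <= M r + E r); [|lra].
    apply (nondecreasing_of_derive_nonneg (fun x => M x + E x)
      (fun x => 1 * x ^ (2 * S n) + (-1) ^ S n * x ^ (2 * S n) / (1 + x ^ 2))); [assumption| |].
    + intros x _. now apply (is_derive_plus (V := R_NormedModule)).
    + intros x _. specialize (B x). apply Rabs_le_between in B. lra.
  - assert (M 0 - E 0 <= M r - E r); [|lra].
    apply (nondecreasing_of_derive_nonneg (fun x => M x - E x)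
      (fun x => 1 * x ^ (2 * S n) - (-1) ^ S n * x ^ (2 * S n) / (1 + x ^ 2))); [assumption| |].
    + intros x _. now apply (is_derive_minus (V := R_NormedModule)).
    + intros x _. specialize (B x). apply Rabs_le_between in B. lra.
Qed.

(** The mean value theorem compares [F] with the termwise primitive of the series of [atan r / r],
    with error at most [1 / (n + 1)]. The formula for [dF] is asked only on the open interval, where
    the mean value point lies. *)
Lemma Catalan_of_derive_atan (F dF : R -> R) :
  (forall r, 0 <= r <= 1 -> is_derive F r (dF r)) ->
  (forall r, 0 < r < 1 -> dF r = atan r / r) ->
  F 1 - F 0 = Catalan.
Proof.
  intros HF HdF. symmetry. apply is_series_unique.
  change (is_lim_seq (sum_n (fun n => (-1) ^ n / (2 * INR n + 1) ^ 2)) (F 1 - F 0)).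
  assert (B : forall n, Rabs (sum_n (fun n => (-1) ^ n / (2 * INR n + 1) ^ 2) n - (F 1 - F 0))
     <= / INR (S n)).
  { intros n.
    (* One factor [1 / (2k + 1)] comes from the arctangent series, the other from integration, so
       [T 1] is a partial sum of the Catalan series. *)
    set (T := fun x => sum_n (fun k => (-1) ^ k / (2 * INR k + 1) * x ^ (2 * k + 1) / (2 * INR k + 1)) n).
    destruct (MVT_cor2 (fun x => F x - T x)
      (fun x => dF x - sum_n (fun k => (-1) ^ k / (2 * INR k + 1) * x ^ (2 * k)) n) 0 1) as [c [E Hc]].
    - lra.
    - intros c Hc. apply is_derive_Reals, (is_derive_minus (V := R_NormedModule)); [now apply HF|].
      apply (is_derive_sum_n (V := R_NormedModule)). intros k _. apply is_derive_pow_odd.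
    - assert (T0 : T 0 = 0).
      { unfold T. rewrite (sum_n_ext _ (fun _ => 0)), sum_n_const; [real_eq; ring|].
        intros k. rewrite pow_i by lia. unfold Rdiv. real_eq. ring. }
      assert (T1 : T 1 = sum_n (fun n => (-1) ^ n / (2 * INR n + 1) ^ 2) n).
      { apply sum_n_ext. intros k. assert (H := odd_denominator_pos k).
        rewrite pow1. simpl. real_eq. field. lra. }
      rewrite <- T1, Rabs_minus_sym.
      replace (F 1 - F 0 - T 1) with (F 1 - T 1 - (F 0 - T 0)) by (rewrite T0; ring).
      rewrite E, (HdF c Hc).
      assert (A := atan_partial_sum_bound n c (proj1 Hc)).
      replace (sum_n (fun k => (-1) ^ k / (2 * INR k + 1) * c ^ (2 * k)) n)
        with (/ c * sum_n (fun k => (-1) ^ k * c ^ (2 * k + 1) / (2 * INR k + 1)) n).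
      2:{ rewrite <- (sum_n_mult_l (K := R_Ring)). apply sum_n_ext. intros k.
          assert (H := odd_denominator_pos k). unfold mult; simpl.
          rewrite pow_add, pow_1. real_eq. field. lra. }
      match type of A with Rabs (_ - ?s) <= _ =>
        replace ((atan c / c - / c * s) * (1 - 0)) with (/ c * (atan c - s)) by (field; lra) end.
      rewrite Rabs_mult, Rabs_inv, (Rabs_pos_eq c) by lra.
      apply Rmult_le_reg_l with c; [lra|].
      rewrite <- Rmult_assoc, Rinv_r, Rmult_1_l by lra.
      apply Rle_trans with (1 := A).
      assert (0 < INR (S n)) by apply lt_0_INR, Nat.lt_0_succ.
      replace (c ^ (2 * S n + 1) / (2 * INR (S n) + 1))
        with (c * (c ^ (2 * S n) * / (2 * INR (S n) + 1)))
        by (rewrite pow_add, pow_1; field; lra).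
      apply Rmult_le_compat_l; [lra|].
      (* After cancelling [c], the bound [c^(2n+2) / (2n + 3)] is weakened to [1 / (n + 1)]. *)
      assert (0 <= c ^ (2 * S n) <= 1).
      { split; [apply pow_le; lra|]. rewrite <- (pow1 (2 * S n)). apply pow_incr. lra. }
      assert (0 < / (2 * INR (S n) + 1)) by (apply Rinv_0_lt_compat; lra).
      assert (/ (2 * INR (S n) + 1) <= / INR (S n)) by (apply Rinv_le_contravar; lra).
      nra. }
  apply is_lim_seq_ext with
    (fun n => sum_n (fun n => (-1) ^ n / (2 * INR n + 1) ^ 2) n - (F 1 - F 0) + (F 1 - F 0));
    [intros; ring|].
  evar_last.
  - apply is_lim_seq_plus' with (2 := is_lim_seq_const (F 1 - F 0)).
    apply is_lim_seq_abs_0.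
    apply is_lim_seq_le_le with (u := fun _ => 0) (w := fun n => / INR (S n)).
    + intros n. split; [apply Rabs_pos | apply B].
    + apply is_lim_seq_const.
    + apply (is_lim_seq_incr_1 (fun n => / INR n)).
      evar_last; [apply is_lim_seq_inv; [apply is_lim_seq_INR | discriminate] | reflexivity].
  - now rewrite Rplus_0_l.
Qed.

(** * Values of the logarithmic integrals *)

Lemma is_RInt_ln_one_plus_sqr :
  is_RInt (fun x => ln (1 + x ^ 2) / (1 + x ^ 2)) 0 1 (PI / 2 * ln 2 - Catalan).
Proof.
  set (F := fun r => RInt (fun x =>
    ln (1 + x ^ 2 + 2 * (1 - x ^ 2) * r + (1 + x ^ 2) * r ^ 2) / (1 + x ^ 2)) 0 1).
  assert (HF : F 1 - F 0 = Catalan).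
  { eapply Catalan_of_derive_atan; [|apply RInt_poisson_derivative].
    intros r Hr.
    apply (is_derive_RInt_ln_quadratic (fun x => 1 + x ^ 2) (fun x => 2 * (1 - x ^ 2)) (fun x => 1 + x ^ 2));
      try (intros x; apply continuity_pt_of_ex_derive; auto_derive; auto).
    (* The quadratic equals [(1 + t)^2 + ((1 - t) x)^2], positive on this open set, which contains
       the endpoint [t = 0]. *)
    apply (filter_imp (fun t => -1 < t)); [|apply (open_gt (-1)); lra].
    intros t Ht x.
    assert (0 < (1 + t) ^ 2) by (apply pow2_gt_0; lra).
    assert (0 <= ((1 - t) * x) ^ 2) by apply pow2_ge_0.
    nra. }
  assert (E0 : F 0 = RInt (fun x => ln (1 + x ^ 2) / (1 + x ^ 2)) 0 1).
  { apply RInt_ext. intros x _. do 2 f_equal. ring. }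
  assert (E1 : F 1 = PI / 2 * ln 2).
  { apply is_RInt_unique.
    apply (is_RInt_ext (fun x => 2 * ln 2 / (1 + x ^ 2))).
    - intros x _. f_equal.
      replace (1 + x ^ 2 + 2 * (1 - x ^ 2) * 1 + (1 + x ^ 2) * 1 ^ 2) with (2 * 2) by ring.
      rewrite ln_mult by lra. ring.
    - apply is_RInt_antiderivative with (fun x => 2 * ln 2 * atan x).
      + intros x _. assert (0 < 1 + x ^ 2) by nra.
        auto_derive; [auto|]. unfold Rsqr. field. simpl in *. lra.
      + intros x _. auto_derive. nra.
      + rewrite atan_1, atan_0. field. }
  replace (PI / 2 * ln 2 - Catalan) with (RInt (fun x => ln (1 + x ^ 2) / (1 + x ^ 2)) 0 1)
    by (rewrite <- E0; lra).
  apply (RInt_correct (V := R_CompleteNormedModule)), (ex_RInt_continuous (V := R_CompleteNormedModule)).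
  intros x _. apply (ex_derive_continuous (V := R_NormedModule)). auto_derive. simpl in *. nra.
Qed.

Lemma is_RInt_ln_quartic (p : R) : -1 < p < 1 ->
  is_RInt (fun x => ln ((x ^ 2) ^ 2 - 2 * p * x ^ 2 + 1) / (1 + x ^ 2)) 0 1
    (PI / 2 * ln 2 - 2 * Catalan + PI / 2 * ln (1 + sqrt ((1 - p) / 2))).
Proof.
  intros Hp. set (t := sqrt ((1 - p) / 2)).
  assert (t2 : t ^ 2 = (1 - p) / 2) by (apply pow2_sqrt; lra).
  assert (Ht : 0 < t < 1).
  { split; [apply sqrt_lt_R0; lra|]. rewrite <- sqrt_1. apply sqrt_lt_1; lra. }
  set (K := fun t => RInt (fun x =>
    ln ((1 - x ^ 2) ^ 2 + 0 * t + 4 * x ^ 2 * t ^ 2) / (1 + x ^ 2)) 0 1).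
  assert (HK : K 1 - K t = PI / 2 * ln 2 - PI / 2 * ln (1 + t)).
  (* The derivative of [K s - PI / 2 * ln (1 + s)] vanishes strictly between [t] and 1, so the mean
     value theorem equates its endpoint values. *)
  { destruct (MVT_cor2 (fun s => K s - PI / 2 * ln (1 + s)) (fun s =>
        RInt (fun x => (0 + 4 * x ^ 2 * (2 * s)) /
          ((1 - x ^ 2) ^ 2 + 0 * s + 4 * x ^ 2 * s ^ 2) / (1 + x ^ 2)) 0 1 - PI / 2 / (1 + s))
      t 1 (proj2 Ht)) as [c [E Hc]].
    - intros s Hs. apply is_derive_Reals, (is_derive_minus (V := R_NormedModule)).
      + apply (is_derive_RInt_ln_quadratic (fun x => (1 - x ^ 2) ^ 2) (fun _ => 0) (fun x => 4 * x ^ 2));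
          try (intros x; apply continuity_pt_of_ex_derive; auto_derive; auto).
        apply (filter_imp (fun u => 0 < u)); [|apply (open_gt 0); lra].
        intros u Hu x.
        assert (0 < u ^ 2) by (apply pow2_gt_0; lra).
        assert (0 <= (1 - x ^ 2) ^ 2) by apply pow2_ge_0.
        destruct (Req_dec x 0) as [-> |]; [lra|].
        assert (0 < x ^ 2) by now apply pow2_gt_0.
        nra.
      + auto_derive; [lra|]. field. lra.
    - rewrite RInt_quartic_derivative in E by lra.
      replace (1 + 1) with 2 in E by ring. lra. }
  assert (K1 : K 1 = 2 * (PI / 2 * ln 2 - Catalan)).
  { apply is_RInt_unique.
    apply (is_RInt_ext (fun x => 2 * (ln (1 + x ^ 2) / (1 + x ^ 2)))).
    - intros x _.
      replace ((1 - x ^ 2) ^ 2 + 0 * 1 + 4 * x ^ 2 * 1 ^ 2) with ((1 + x ^ 2) * (1 + x ^ 2)) by ring.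
      assert (0 < 1 + x ^ 2) by nra.
      rewrite ln_mult by lra. real_eq. field. lra.
    - apply (is_RInt_scal (V := R_NormedModule)), is_RInt_ln_one_plus_sqr. }
  apply (is_RInt_ext (fun x => ln ((1 - x ^ 2) ^ 2 + 0 * t + 4 * x ^ 2 * t ^ 2) / (1 + x ^ 2))).
  (* Since [4 t^2 = 2 (1 - p)], the family at [t] is the given quartic. *)
  { intros x _. rewrite t2. do 2 f_equal. field. }
  replace (PI / 2 * ln 2 - 2 * Catalan + PI / 2 * ln (1 + t)) with (K t) by lra.
  apply (RInt_correct (V := R_CompleteNormedModule)), (ex_RInt_continuous (V := R_CompleteNormedModule)).
  rewrite Rmin_left, Rmax_right by lra.
  intros x Hx. apply (ex_derive_continuous (V := R_NormedModule)). auto_derive.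
  assert (0 < t ^ 2) by (apply pow2_gt_0; lra).
  assert (0 <= (1 - x ^ 2) ^ 2) by apply pow2_ge_0.
  assert (0 < (1 - x ^ 2) ^ 2 + 0 * t + 4 * x ^ 2 * t ^ 2).
  { destruct (Req_dec x 0) as [-> |]; [lra|].
    assert (0 < x ^ 2) by now apply pow2_gt_0. nra. }
  assert (0 < 1 + x ^ 2) by nra.
  simpl in *. repeat split; lra.
Qed.

(** ** Assembling the factors *)

(** Named for its degree in [x], since it is integrated at [y = x^2]. *)
Definition quartic (m : nat) (y : R) (k : nat) : R := y ^ 2 - 2 * phi m k * y + 1.

(** On this open interval sine is positive and cosine injective, which yields nonzero sines and
    distinct quadratics. *)
Lemma phi_angle_bounds (m k : nat) : (2 * k + 1 < m)%nat ->
  0 < (2 * INR k + 1) * PI / INR m < PI.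
Proof.
  intros H. assert (P := PI_RGT_0). assert (K := pos_INR k).
  apply lt_INR in H. rewrite plus_INR, mult_INR in H. simpl (INR 2) in H. simpl (INR 1) in H.
  split.
  - apply Rdiv_lt_0_compat; [apply Rmult_lt_0_compat|]; lra.
  - apply Rmult_lt_reg_r with (INR m); [lra|].
    unfold Rdiv. rewrite Rmult_assoc, Rinv_l by lra.
    rewrite Rmult_1_r, (Rmult_comm PI). apply Rmult_lt_compat_r; lra.
Qed.

Lemma phi_bounds (m k : nat) : (2 * k + 1 < m)%nat -> -1 < phi m k < 1.
Proof.
  intros H. apply phi_angle_bounds in H. unfold phi. revert H.
  generalize ((2 * INR k + 1) * PI / INR m). intros th H. split.
  - rewrite <- cos_PI. apply cos_decreasing_1; lra.
  - rewrite <- cos_0. apply cos_decreasing_1; lra.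
Qed.

Lemma phi_inj (m i j : nat) : (2 * i + 1 < m)%nat -> (2 * j + 1 < m)%nat ->
  phi m i = phi m j -> i = j.
Proof.
  intros Hi Hj E.
  assert (Bi := phi_angle_bounds _ _ Hi). assert (Bj := phi_angle_bounds _ _ Hj).
  apply cos_inj in E; try lra.
  assert (0 < INR m) by (apply lt_0_INR; lia). assert (P := PI_RGT_0).
  apply INR_eq, Rmult_eq_reg_r with (2 * PI / INR m).
  - unfold Rdiv in *. lra.
  - apply Rgt_not_eq, Rdiv_lt_0_compat; lra.
Qed.

(** Since [m th = (2k + 1) PI], the angle [(m - 1) th] is [PI - th] up to a multiple of [2 PI]. *)
Lemma phi_angle_sin (m k : nat) (th := (2 * INR k + 1) * PI / INR m) : (2 * k + 1 < m)%nat ->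
  sin th <> 0 /\ sin (INR m * th) = 0 /\ sin (INR (Nat.pred m) * th) = sin th.
Proof.
  intros H. assert (B := phi_angle_bounds _ _ H). fold th in B.
  assert (0 < INR m) by (apply lt_0_INR; lia).
  assert (E : INR m * th = PI + 2 * INR k * PI) by (unfold th; field; lra).
  split; [|split].
  - apply Rgt_not_eq, sin_gt_0; lra.
  - rewrite E, sin_period. apply sin_PI.
  - destruct m as [|n]; [lia|]. simpl (Nat.pred _).
    replace (INR n * th) with (PI - th + 2 * INR k * PI) by (rewrite S_INR in E; lra).
    rewrite sin_period. apply sin_PI_x.
Qed.

(** Completing the square leaves [1 - phi^2 > 0]. *)
Lemma quartic_pos (m k : nat) (y : R) : -1 < phi m k < 1 -> 0 < quartic m y k.
Proof.
  unfold quartic. intros H.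
  assert (0 <= (y - phi m k) ^ 2) by apply pow2_ge_0.
  assert (0 < (1 - phi m k) * (1 + phi m k)) by (apply Rmult_lt_0_compat; lra). nra.
Qed.

Lemma prod_quartic_pos (m : nat) (l : list nat) (y : R) :
  (forall k, In k l -> -1 < phi m k < 1) -> 0 < fold_right Rmult 1 (map (quartic m y) l).
Proof.
  induction l as [|k l IH]; simpl; intros H; [lra|].
  apply Rmult_lt_0_compat; [apply quartic_pos|]; auto.
Qed.

(** Positive factors let the logarithm split. An arbitrary index list makes the induction direct,
    each entry adding one quartic integral. *)
Lemma is_RInt_ln_prod_quartic (m : nat) (l : list nat) :
  (forall k, In k l -> -1 < phi m k < 1) ->
  is_RInt (fun x => ln (fold_right Rmult 1 (map (quartic m (x ^ 2)) l)) / (1 + x ^ 2)) 0 1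
    (INR (length l) * (PI / 2 * ln 2 - 2 * Catalan)
     + PI / 2 * fold_right Rplus 0 (map (fun k => ln (1 + sqrt ((1 - phi m k) / 2))) l)).
Proof.
  induction l as [|k l IH]; intros H.
  - simpl. apply (is_RInt_ext (fun _ => (0 : R))).
    { intros x _. rewrite ln_1. symmetry. apply Rmult_0_l. }
    evar_last; [apply (is_RInt_const (V := R_NormedModule))|].
    unfold scal; simpl; unfold mult; simpl. real_eq. lra.
  - assert (Hl : forall j, In j l -> -1 < phi m j < 1) by (intros; apply H; now right).
    assert (Hk := H k (or_introl eq_refl)).
    apply (is_RInt_ext (fun x => plus (ln ((x ^ 2) ^ 2 - 2 * phi m k * x ^ 2 + 1) / (1 + x ^ 2))
      (ln (fold_right Rmult 1 (map (quartic m (x ^ 2)) l)) / (1 + x ^ 2)))).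
    { intros x _. change (plus ?a ?b) with (a + b).
      change (fold_right Rmult 1 (map (quartic m (x ^ 2)) (k :: l)))
        with (quartic m (x ^ 2) k * fold_right Rmult 1 (map (quartic m (x ^ 2)) l)).
      rewrite ln_mult.
      - unfold quartic at 2. real_eq. unfold Rdiv. ring.
      - now apply quartic_pos.
      - now apply prod_quartic_pos. }
    evar_last; [apply (is_RInt_plus (V := R_NormedModule)); [apply is_RInt_ln_quartic, Hk | apply IH, Hl]|].
    change (plus ?a ?b) with (a + b). change (length (k :: l)) with (S (length l)).
    rewrite S_INR. simpl. lra.
Qed.

Lemma pow_add1_even_phi (m n : nat) (y : R) : m = (2 * n)%nat -> (0 < n)%nat ->
  y ^ m + 1 = fold_right Rmult 1 (map (quartic m y) (seq 0 n)).
Proof.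
  intros Hm Hn.
  apply (@Factorization.pow_add1_even m n (fun k => (2 * INR k + 1) * PI / INR m)); auto.
  - intros i Hi. apply phi_angle_sin. lia.
  - intros i j Hi Hj. apply phi_inj; lia.
Qed.

Lemma pow_add1_odd_phi (m n : nat) (y : R) : m = (2 * n + 1)%nat ->
  y ^ m + 1 = (y + 1) * fold_right Rmult 1 (map (quartic m y) (seq 0 n)).
Proof.
  intros Hm.
  apply (@Factorization.pow_add1_odd m n (fun k => (2 * INR k + 1) * PI / INR m)); auto.
  - intros i Hi. apply phi_angle_sin. lia.
  - intros i j Hi Hj. apply phi_inj; lia.
Qed.

(** * Evaluation for even and odd exponents *)

Theorem theorem2p5 :
  (forall m : nat, Nat.Even m -> (2 <= m)%nat ->
     is_RInt (fun x : R => ln (x ^ (2 * m) + 1) / (x ^ 2 + 1)) 0 1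
       (INR m * PI / 4 * ln 2 - INR m * Catalan
        + PI / 2 * sum_lt (fun k : nat => ln (1 + sqrt ((1 - phi m k) / 2)))
                          (m / 2)%nat))
  /\
  (forall m : nat, Nat.Odd m -> (1 <= m)%nat ->
     is_RInt (fun x : R => ln (x ^ (2 * m) + 1) / (x ^ 2 + 1)) 0 1
       ((INR m + 1) * PI / 4 * ln 2 - INR m * Catalan
        + PI / 2 * sum_lt (fun k : nat => ln (1 + sqrt ((1 - phi m k) / 2)))
                          ((m - 1) / 2)%nat)).
Proof.
  assert (B : forall m n, (2 * n <= m)%nat -> forall k, In k (seq 0 n) -> -1 < phi m k < 1).
  { intros m n H k Hk. apply in_seq in Hk. apply phi_bounds. lia. }
  split; intros m [n Hm] H.
  - replace (m / 2)%nat with n by (rewrite Hm, Nat.mul_comm, Nat.div_mul; lia).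
    apply (is_RInt_ext (fun x => ln (fold_right Rmult 1 (map (quartic m (x ^ 2)) (seq 0 n))) / (1 + x ^ 2))).
    { intros x _. rewrite pow_mult, (pow_add1_even_phi m n), (Rplus_comm 1) by lia. reflexivity. }
    (* The [n = m / 2] factors contribute [n (PI / 2 ln 2 - 2 G) = m PI / 4 ln 2 - m G]. *)
    evar_last; [apply is_RInt_ln_prod_quartic, B; lia|].
    rewrite length_seq. unfold sum_lt. real_eq.
    replace (INR m) with (2 * INR n) by (rewrite Hm, mult_INR; simpl; lra). field.
  (* Here [m = 2n + 1], so the indices run up to [n - 1 = (m - 3) / 2]; for [m = 1] the sum is
     empty. *)
  - replace ((m - 1) / 2)%nat with n
      by (rewrite Hm, Nat.add_sub, Nat.mul_comm, Nat.div_mul; lia).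
    assert (P : forall x, 0 < fold_right Rmult 1 (map (quartic m (x ^ 2)) (seq 0 n))).
    { intros x. apply prod_quartic_pos, B. lia. }
    apply (is_RInt_ext (fun x => plus (ln (1 + x ^ 2) / (1 + x ^ 2))
      (ln (fold_right Rmult 1 (map (quartic m (x ^ 2)) (seq 0 n))) / (1 + x ^ 2)))).
    { intros x _. change (plus ?a ?b) with (a + b).
      rewrite pow_mult, (pow_add1_odd_phi m n), (Rplus_comm (x ^ 2)) by lia.
      rewrite ln_mult by (auto; nra). real_eq. unfold Rdiv. ring. }
    (* The factor [1 + x^2] adds [PI / 2 ln 2 - G] to the [n] quartic terms, giving
       [(n + 1) PI / 2 ln 2 - (2n + 1) G]. *)
    evar_last; [apply (is_RInt_plus (V := R_NormedModule));
      [apply is_RInt_ln_one_plus_sqr | apply is_RInt_ln_prod_quartic, B; lia]|].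
    change (plus ?a ?b) with (a + b).
    rewrite length_seq. unfold sum_lt. real_eq.
    replace (INR m) with (2 * INR n + 1) by (rewrite Hm, plus_INR, mult_INR; simpl; lra). field.
Qed.
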